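(* If a measure $\mu$ on a measurable space $(E,\mathcal E)$ is non-atomic, then $(\widetilde{\mathcal E},d_\mu)$ is not compact and is not locally compact.
   Context: A set $A\in\mathcal E$ is an atom of $\mu$ if $0<\mu(A)<\infty$ and for every $C\subset A$ with $C\in\mathcal E$, either $\mu(C)=0$ or $\mu(C)=\mu(A)$. A measure without any atoms is called non-atomic. For $A\in\mathcal E$ let $[A]=\{B\in\mathcal E:\mu(A\Delta B)=0\}$, where $\Delta$ is symmetric difference, and $\widetilde{\mathcal E}=\{[A]:A\in\mathcal E\}$, with the metric (possibly taking the value $\infty$) $d_\mu([A],[B])=\mu(A\Delta B)^{1/2}$ and the topology it generates. A topological space is locally compact if every point has a compact neighbourhood.
   Formalization: The formal theorem also assumes that some measurable set has finite positive measure; without it the claim fails, since a measure taking only the values 0 and ∞ is non-atomic but gives a discrete, hence locally compact, space (a single point, so compact, when the measure is zero). *)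

(* Defs.v *)
From HB Require Import structures.
From mathcomp Require Import all_boot all_order all_algebra.
From mathcomp Require Import all_classical all_reals all_analysis.

Set Implicit Arguments.
Unset Strict Implicit.
Unset Printing Implicit Defensive.

Import Order.TTheory GRing.Theory Num.Theory.

Local Open Scope classical_set_scope.
Local Open Scope ring_scope.
Local Open Scope ereal_scope.

Section MeasureAlgebra.
Context (d : measure_display) (T : measurableType d) (R : realType).
Variable mu : {measure set T -> \bar R}.

Definition atom (A : set T) : Prop :=
  [/\ measurable A, 0 < mu A < +oo &
      forall C, measurable C -> C `<=` A -> mu C = 0 \/ mu C = mu A].

Definition non_atomic : Prop := forall A, ~ atom A.

Definition mclass (A : set T) : set (set T) :=
  [set B | measurable B /\ mu (A `+` B) = 0].

Definition malgebra : Type := set_type [set mclass A | A in measurable].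

HB.instance Definition _ := Choice.on malgebra.

Lemma to_malgebra_subproof (A : set T) : measurable A ->
  mclass A \in [set mclass A | A in measurable].
Proof. by move=> mA; rewrite inE; exists A. Qed.

Definition to_malgebra (A : set T) (mA : measurable A) : malgebra :=
  exist _ (mclass A) (to_malgebra_subproof mA).

Lemma malgebra_ex (x : malgebra) :
  exists2 A, measurable A & mclass A = val x.
Proof. by have := valP x; rewrite inE. Qed.

Definition mrepr (x : malgebra) : set T := s2val (cid2 (malgebra_ex x)).

(* The value does not depend on the representatives: see [dmuE]. *)
Definition dmu (x y : malgebra) : \bar R :=
  mu (mrepr x `+` mrepr y) `^ 2^-1.

Lemma measurable_mrepr x : measurable (mrepr x).
Proof. by rewrite /mrepr; case: cid2. Qed.

Lemma mclass_mrepr x : mclass (mrepr x) = val x.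
Proof. by rewrite /mrepr; case: cid2. Qed.

Local Lemma mY (A B : set T) :
  measurable A -> measurable B -> measurable (A `+` B).
Proof. by move=> mA mB; apply: measurableU; exact: measurableD. Qed.

Lemma mu_setY_triangle (A B C : set T) :
  measurable A -> measurable B -> measurable C ->
  mu (A `+` C) <= mu (A `+` B) + mu (B `+` C).
Proof.
move=> mA mB mC; apply: (@le_trans _ _ (mu ((A `+` B) `|` (B `+` C)))).
  apply: le_measure; rewrite ?inE; [exact: mY|apply: measurableU; exact: mY|].
  by move=> t /=; case: (pselect (B t)); tauto.
by apply: measureU2; exact: mY.
Qed.

Lemma mclass_refl (A : set T) : measurable A -> mclass A A.
Proof. by move=> mA; split => //; rewrite setYK measure0. Qed.

Lemma eq_mclass (A B : set T) : measurable A -> measurable B ->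
  mclass A = mclass B <-> mu (A `+` B) = 0.
Proof.
move=> mA mB; split=> [AB|AB0].
  by have [_] : mclass A B by rewrite AB; exact: mclass_refl.
apply/seteqP; split=> C [mC C0]; split=> //; apply/eqP;
  rewrite -measure_le0.
- by rewrite (le_trans (mu_setY_triangle mB mA mC))// C0 adde0 setYC AB0.
- by rewrite (le_trans (mu_setY_triangle mA mB mC))// C0 adde0 AB0.
Qed.

Lemma dmuE (A B : set T) (mA : measurable A) (mB : measurable B) :
  dmu (to_malgebra mA) (to_malgebra mB) = mu (A `+` B) `^ 2^-1.
Proof.
rewrite /dmu; congr (_ `^ _).
have mA' := measurable_mrepr (to_malgebra mA).
have mB' := measurable_mrepr (to_malgebra mB).
have /eq_mclass A0 := mclass_mrepr (to_malgebra mA).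
have /eq_mclass B0 := mclass_mrepr (to_malgebra mB).
apply/eqP; rewrite eq_le; apply/andP; split.
- rewrite (le_trans (mu_setY_triangle mA' mA mB'))// A0// add0e.
  by rewrite (le_trans (mu_setY_triangle mA mB mB'))// (setYC B) B0// adde0.
- rewrite (le_trans (mu_setY_triangle mA mA' mB))// (setYC A) A0// add0e.
  by rewrite (le_trans (mu_setY_triangle mA' mB' mB))// B0// adde0.
Qed.

Lemma dmuxx x : dmu x x = 0.
Proof. by rewrite /dmu setYK measure0 poweR0r. Qed.

Lemma dmu_eq0 x y : dmu x y = 0 -> x = y.
Proof.
move=> /poweR_eq0_eq0 xy0; apply: val_inj.
rewrite -!mclass_mrepr; apply/eq_mclass; [exact: measurable_mrepr..|].
exact: xy0.
Qed.

Lemma dmu_sym x y : dmu x y = dmu y x.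
Proof. by rewrite /dmu setYC. Qed.

Local Lemma poweR_half_subadd (a b : \bar R) : 0 <= a -> 0 <= b ->
  (a + b) `^ 2^-1 <= a `^ 2^-1 + b `^ 2^-1.
Proof.
move=> a0 b0; rewrite !poweR12_sqrt ?adde_ge0//.
case: a b a0 b0 => [a| |] [b| |]//=; rewrite !lee_fin => a0 b0.
rewrite -[leRHS]ger0_norm ?addr_ge0 ?sqrtr_ge0// -sqrtr_sqr.
rewrite ler_sqrt ?sqr_ge0// sqrrD !sqr_sqrtr// lerD2r lerDl.
by rewrite mulrn_wge0// mulr_ge0 ?sqrtr_ge0.
Qed.

Lemma dmu_triangle x y z : dmu x z <= dmu x y + dmu y z.
Proof.
apply: le_trans (poweR_half_subadd _ _) => //.
apply: gt0_ler_poweR => //; rewrite ?in_itv/= ?leey ?andbT ?adde_ge0//.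
by apply: mu_setY_triangle; exact: measurable_mrepr.
Qed.

(* The library's metric structures take finite distances only, so the extended
   metric is given to them through its open balls. *)
Definition dmu_ball (x : malgebra) (e : R) : set malgebra :=
  [set y | dmu x y < e%:E].

Let ent : set_system (malgebra * malgebra) := entourage_ dmu_ball.

HB.instance Definition _ := hasNbhs.Build malgebra (nbhs_ ent).

Let ball_center x (e : R) : (0 < e)%R -> dmu_ball x e x.
Proof. by move=> e0; rewrite /dmu_ball/= dmuxx lte_fin. Qed.

Let ball_sym x y (e : R) : dmu_ball x e y -> dmu_ball y e x.
Proof. by rewrite /dmu_ball/= dmu_sym. Qed.

Let ball_triangle x y z (e1 e2 : R) :
  dmu_ball x e1 y -> dmu_ball y e2 z -> dmu_ball x (e1 + e2)%R z.
Proof.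
rewrite /dmu_ball/= => xy yz; apply: le_lt_trans (dmu_triangle x y z) _.
by rewrite EFinD lteD.
Qed.

HB.instance Definition _ := @Nbhs_isPseudoMetric.Build R malgebra
  ent erefl dmu_ball ball_center ball_sym ball_triangle erefl.

Lemma malgebra_ballE (x : malgebra) (e : R) :
  ball x e = [set y | dmu x y < e%:E].
Proof. by []. Qed.

Lemma malgebra_hausdorff : hausdorff_space malgebra.
Proof.
rewrite ball_hausdorff => x y xy.
have {xy} : 0 < dmu x y.
  rewrite lt0e poweR_ge0 andbT; apply/eqP => /dmu_eq0 xy0.
  by rewrite xy0 eqxx in xy.
move=> dxy.
have [e e0 exy] : exists2 e : R, (0 < e)%R & (e + e)%:E <= dmu x y.
  move: dxy; case: (dmu x y) => [r| |]//=.
    by rewrite lte_fin => r0; exists (r / 2)%R; rewrite ?divr_gt0// -splitr.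
  by exists 1%R => //; exact: leey.
exists (PosNum e0, PosNum e0) => /=; apply/eqP; rewrite -subset0.
move=> z [/= xz /ball_sym zy].
by have := ball_triangle xz zy; rewrite /dmu_ball/= ltNge exy.
Qed.

(* The library's [locally_compact] also asks that the compact neighbourhood be
   closed, which is automatic here. *)
Lemma malgebra_locally_compactE : locally_compact [set: malgebra] <->
  forall x : malgebra, exists2 U, nbhs x U & compact U.
Proof.
split=> lc x => [|_].
  have [U xU [cU _]] := lc x I; exists U => //.
  by move: xU; rewrite /within/=; apply: filterS => t; exact.
have [U xU cU] := lc x; exists U.
  by rewrite /within/=; apply: filterS xU.
by split => //; exact: compact_closed malgebra_hausdorff cU.
Qed.

(* A measure with values in {0, +oo} has no atoms, so non-atomicity alone does
   not prevent local compactness (nor compactness, as the zero measure shows):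
   a measurable set of positive finite measure is needed. *)
Lemma malgebra_locally_compact_degenerate :
  (forall A, measurable A -> ~ 0 < mu A < +oo) ->
  non_atomic /\ locally_compact [set: malgebra].
Proof.
move=> mu0y; split=> [A [mA A0y _]|]; first exact: mu0y A0y.
apply/malgebra_locally_compactE => x; exists [set x]; last exact: compact_set1.
rewrite -nbhs_ballE; exists 1%R => //= y.
rewrite malgebra_ballE/= => xy1; apply/esym/dmu_eq0.
have mxy := mY (measurable_mrepr x) (measurable_mrepr y).
apply/eqP; rewrite /dmu poweR_eq0//; apply/andP; split; last first.
  by rewrite invr_eq0.
apply: contra_notT (mu0y _ mxy) => xy0; rewrite lt0e xy0 measure_ge0/=.
apply: (@lty_poweRy _ _ 2^-1); first by rewrite invr_eq0.
by rewrite (lt_trans xy1)// ltry.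
Qed.

Lemma malgebra_compact_zero :
  (forall A, measurable A -> mu A = 0) ->
  non_atomic /\ compact [set: malgebra].
Proof.
move=> mu0; split=> [A [mA]|]; first by rewrite mu0// ltxx.
suff -> : [set: malgebra] = [set to_malgebra measurable0].
  exact: compact_set1.
apply/seteqP; split=> // x _; apply: dmu_eq0.
rewrite /dmu mu0 ?poweR0r ?invr_eq0//; apply: mY; exact: measurable_mrepr.
Qed.

End MeasureAlgebra.

(* Main.v *)
(* Inside any ball around the class of the empty set there are all measurable
   subsets of some B with 0 < mu B < +oo. Given finitely many sets C, half of B
   (in measure) inside each atom of the algebra they generate is a subset D of B
   with mu (B `&` (D `+` C)) = mu B / 2 for every such C. So no finite family of
   balls of radius (mu B / 2)^(1/2) covers a neighbourhood of that class. The
   exact halving is Sierpinski's theorem on the values of a non-atomic measure. *)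
Require Import Defs.
From mathcomp Require Import all_boot all_order all_algebra.
From mathcomp Require Import all_classical all_reals all_analysis.
From mathcomp Require Import lra.

Set Implicit Arguments.
Unset Strict Implicit.
Unset Printing Implicit Defensive.

Import Order.TTheory GRing.Theory Num.Theory.
Local Open Scope classical_set_scope.
Local Open Scope ring_scope.
Local Open Scope ereal_scope.

(** * Subsets of small and of prescribed measure *)

Lemma measure_subset_fineK (d : measure_display) (T : measurableType d)
    (R : realType) (mu : {measure set T -> \bar R}) (A B : set T) :
  measurable A -> measurable B -> A `<=` B -> mu B < +oo ->
  mu A = (fine (mu A))%:E.
Proof.
move=> mA mB AB By; rewrite fineK// ge0_fin_numE//.
by apply: le_lt_trans By; apply: le_measure; rewrite ?inE.
Qed.

Lemma measure_splitD (d : measure_display) (T : measurableType d)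
    (R : realType) (mu : {measure set T -> \bar R}) (A B : set T) :
  measurable A -> measurable B -> A `<=` B -> mu B = mu A + mu (B `\` A).
Proof. by move=> mA mB AB; rewrite (measureDI mu mB mA) setIidr// addeC. Qed.

(** Since [A] is not an atom, some [C] splits it into two pieces of positive measure; the smaller
    piece has at most half the measure of [A]. *)
Lemma non_atomic_halve (d : measure_display) (T : measurableType d)
    (R : realType) (mu : {measure set T -> \bar R}) (A : set T) :
  non_atomic mu -> measurable A -> 0 < mu A < +oo ->
  exists D, [/\ measurable D, D `<=` A, 0 < mu D & mu D + mu D <= mu A].
Proof.
move=> na mA A0y; have /andP[A0 Ay] := A0y.
have [C [mC CA C0 CnA]] : exists C, [/\ measurable C, C `<=` A,
    mu C <> 0 & mu C <> mu A].
  apply: contrapT => noC; apply: (na A); split=> // C mC CA.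
  apply: contrapT => /not_orP[C0 CnA]; apply: noC.
  by exists C.
have mAC : measurable (A `\` C) by exact: measurableD.
have split := measure_splitD mu mC mA CA.
have C_gt0 : 0 < mu C by rewrite lt0e measure_ge0 andbT; exact/eqP.
have AC_gt0 : 0 < mu (A `\` C).
  rewrite lt0e measure_ge0 andbT; apply/eqP => AC0; apply: CnA.
  by rewrite split AC0 adde0.
have [le|/ltW le] := leP (mu C) (mu (A `\` C)).
  by exists C; split=> //; rewrite split leeD2l.
by exists (A `\` C); split=> //; rewrite split leeD2r.
Qed.

Lemma non_atomic_small (d : measure_display) (T : measurableType d)
    (R : realType) (mu : {measure set T -> \bar R}) (A : set T) (e : R) :
  non_atomic mu -> measurable A -> 0 < mu A < +oo -> (0 < e)%R ->
  exists D, [/\ measurable D, D `<=` A, 0 < mu D & mu D <= e%:E].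
Proof.
move=> na mA A0y e0; have /andP[A0 Ay] := A0y.
have Afin : mu A = (fine (mu A))%:E := measure_subset_fineK mA mA (@subset_refl _ A) Ay.
set a := fine (mu A) in Afin.
(* Halve [n] times. Since [2 ^ n > n], taking [n] just above [a / e] brings the measure down to
   [e]. *)
suff /(_ (Num.truncn (a / e)).+1)[D [mD DA D0 Dle]] : forall n, exists D,
    [/\ measurable D, D `<=` A, 0 < mu D & (fine (mu D) * (2 ^ n)%:R <= a)%R].
  exists D; split=> //.
  rewrite (measure_subset_fineK mD mA DA Ay) lee_fin leNgt; apply/negP => eD.
  have : (a / e < (2 ^ (Num.truncn (a / e)).+1)%:R)%R.
    by apply: lt_trans (truncnS_gt _) _; rewrite ltr_nat ltn_expl.
  rewrite ltr_pdivrMr// ltNge => /negP; apply; apply: le_trans Dle.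
  by rewrite mulrC ler_wpM2r// ltW.
elim=> [|n [D [mD DA D0 Dle]]].
  by exists A; split=> //; rewrite mulr1.
have Dfin := measure_subset_fineK mD mA DA Ay.
have Dy : mu D < +oo by rewrite Dfin ltry.
have [|E [mE ED E0 Ele]] := non_atomic_halve na mD; first by rewrite D0.
exists E; split=> //; first exact: subset_trans DA.
move: Ele; rewrite (measure_subset_fineK mE mD ED Dy) Dfin -EFinD lee_fin => Ele.
apply: le_trans Dle; rewrite expnS natrM mulrA ler_wpM2r//.
by move: Ele; rewrite mulr_natr mulr2n.
Qed.

(* Greedy exhaustion: [f n.+1] almost reaches, up to 1 / n.+1, the largest measure
   [<= t] of a set between [f n] and [B]; if the union missed [t], a small
   subset of the complement could still have been added. *)
Lemma non_atomic_intermediate (d : measure_display) (T : measurableType d)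
    (R : realType) (mu : {measure set T -> \bar R}) (B : set T) (t : R) :
  non_atomic mu -> measurable B -> mu B < +oo -> (0 <= t)%R -> t%:E <= mu B ->
  exists C, [/\ measurable C, C `<=` B & mu C = t%:E].
Proof.
move=> na mB By t0 tB.
pose adm C := [/\ measurable C, C `<=` B & mu C <= t%:E].
(* The first component counts stages, on which the allowed error depends. The hypotheses [adm p.2]
   make [step] total, as dependent choice requires: a non-admissible set is simply repeated. *)
pose step (p q : nat * set T) := [/\ q.1 = p.1.+1, adm p.2 -> adm q.2, p.2 `<=` q.2 &
  adm p.2 -> forall D, adm D -> p.2 `<=` D -> mu D <= mu q.2 + (p.1.+1%:R^-1)%:E].
have next p : {q | step p q}.
  apply: cid; case: p => n C; have [admC|nadmC] := pselect (adm C); last first.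
    by exists (n.+1, C); split.
  pose S := [set mu D | D in [set D | adm D /\ C `<=` D]].
  have Sfin : ereal_sup S \is a fin_num.
    rewrite ge0_fin_numE; last first.
      apply: (@le_trans _ _ (mu C)) => //; apply: ereal_sup_ubound.
      by exists C => //; split.
    apply: (@le_lt_trans _ _ t%:E); last exact: ltry.
    by apply: ge_ereal_sup => _ [D [[_ _ Dt] _] <-].
  have n0 : (0 < n.+1%:R^-1 :> R)%R by rewrite invr_gt0.
  have [_ [D [admD CD] <-] Dlt] := ub_ereal_sup_adherent n0 Sfin.
  exists (n.+1, D); split=> //= _ E admE CE.
  rewrite -leeBlDr//; apply: le_trans (ltW Dlt).
  by rewrite leeB// ereal_sup_ubound//; exists E => //; split.
have [f [f0 fS]] := dependent_choice next (0%N, set0).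
have f1 n : (f n).1 = n by elim: n => [|n IH]; [rewrite f0|case: (fS n) => -> _ _ _; rewrite IH].
pose F n := (f n).2.
have admF n : adm (F n).
  elim: n => [|n IH]; last by case: (fS n) => _ /(_ IH).
  by rewrite /F f0/=; split=> //; rewrite measure0 lee_fin.
have FS n : F n `<=` F n.+1 by case: (fS n).
have Fmax n D : adm D -> F n `<=` D -> mu D <= mu (F n.+1) + (n.+1%:R^-1)%:E.
  by case: (fS n) => _ _ _ /(_ (admF n)); rewrite f1 => + ? ?; apply.
have mF n : measurable (F n) by case: (admF n).
pose C := \bigcup_n F n.
have mC : measurable C by exact: bigcup_measurable.
have CB : C `<=` B by move=> x [n _]; case: (admF n) => _ + _; apply.
have Ct : mu C <= t%:E.
  apply: (@cvge_le nat \oo _ R (mu \o F)).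
    by near=> n; case: (admF n).
  apply: nondecreasing_cvg_mu => //.
  by apply/nondecreasing_seqP => n; apply/subsetPset.
exists C; split=> //; apply/eqP; rewrite eq_le Ct/= leNgt; apply/negP => Clt.
have Cfin := measure_subset_fineK mC mB CB By.
have mBC : measurable (B `\` C) by exact: measurableD.
have BC := measure_splitD mu mC mB CB.
have BCfin := measure_subset_fineK mBC mB (@subDsetl _ B C) By.
have BC0 : 0 < mu (B `\` C) < +oo.
  rewrite BCfin ltry andbT lte_fin.
  move: tB Clt; rewrite BC Cfin BCfin -EFinD lee_fin lte_fin; lra.
have e0 : (0 < t - fine (mu C))%R.
  by rewrite subr_gt0 -lte_fin -Cfin.
have [E [mE EBC E0 Ee]] := non_atomic_small na mBC BC0 e0.
have EB : E `<=` B by move=> x /EBC[].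
have Efin := measure_subset_fineK mE mB EB By.
have CE : mu (C `|` E) = mu C + mu E.
  by rewrite measureU//; apply/seteqP; split=> // x [? /EBC[]].
have admCE : adm (C `|` E).
  split; [exact: measurableU|by rewrite subUset|].
  by move: Ee; rewrite CE Cfin Efin -EFinD !lee_fin; lra.
(* [C] together with [E] is admissible and contains every [F n], so near-maximality bounds the gain
   [mu E] by the error of each stage. *)
have Eub n : (fine (mu E) <= n.+1%:R^-1)%R.
  have FCE : F n `<=` C `|` E by move=> x Fx; left; exists n.
  have FC : mu (F n.+1) <= mu C.
    by apply: le_measure; rewrite ?inE// => x Fx; exists n.+1.
  have := le_trans (Fmax n _ admCE FCE) (leeD2r _ FC).
  by rewrite CE Cfin Efin -!EFinD lee_fin lerD2l.
move: E0; rewrite Efin lte_fin => E0.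
have := Eub (Num.truncn (fine (mu E))^-1); rewrite leNgt => /negP; apply.
by rewrite invf_plt ?posrE// truncnS_gt.
Unshelve. all: by end_near.
Qed.

(** * Simultaneous halving *)

Lemma non_atomic_half (d : measure_display) (T : measurableType d)
    (R : realType) (mu : {measure set T -> \bar R}) (B : set T) :
  non_atomic mu -> measurable B -> mu B < +oo ->
  exists D, [/\ measurable D, D `<=` B & (mu D = (fine (mu B) / 2)%:E)].
Proof.
move=> na mB By.
have B0 : (0 <= fine (mu B))%R by rewrite fine_ge0.
apply: non_atomic_intermediate => //.
by rewrite [leRHS](measure_subset_fineK mB mB (@subset_refl _ B) By) lee_fin; lra.
Qed.

(* [D] is half of each atom of the finite algebra generated by [l] in [B]; the
   clause on [mu D] is the case [C = set0], needed for the induction. *)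
Lemma non_atomic_independent (d : measure_display) (T : measurableType d)
    (R : realType) (mu : {measure set T -> \bar R}) (l : seq (set T)) (B : set T) :
  non_atomic mu -> (forall C, C \in l -> measurable C) ->
  measurable B -> mu B < +oo ->
  exists D, [/\ measurable D, D `<=` B, mu D = (fine (mu B) / 2)%:E &
    forall C, C \in l -> mu (B `&` (D `+` C)) = (fine (mu B) / 2)%:E].
Proof.
move=> na; elim: l B => [|C l IH] B ml mB By.
  by have [D [? ? ?]] := non_atomic_half na mB By; exists D; split.
have mC : measurable C by apply: ml; rewrite mem_head.
have ml' C' : C' \in l -> measurable C' by move=> C'l; apply: ml; rewrite inE C'l orbT.
have mI : measurable (B `&` C) by exact: measurableI.
have mD : measurable (B `\` C) by exact: measurableD.
have BE : mu B = mu (B `\` C) + mu (B `&` C) := measureDI mu mB mC.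
have Ifin := measure_subset_fineK mI mB (@subIsetl _ B C) By.
have Dfin := measure_subset_fineK mD mB (@subDsetl _ B C) By.
(* The induction hypothesis is used on both traces of [C] in [B], hence the generalization over
   [B]. *)
have [|D1 [mD1 D1I hD1 D1l]] := IH (B `&` C) ml' mI; first by rewrite Ifin ltry.
have [|D2 [mD2 D2D hD2 D2l]] := IH (B `\` C) ml' mD; first by rewrite Dfin ltry.
have half : (fine (mu B) / 2)%:E =
    (fine (mu (B `&` C)) / 2)%:E + (fine (mu (B `\` C)) / 2)%:E.
  by rewrite BE Dfin Ifin -!EFinD/=; congr EFin; lra.
exists (D1 `|` D2); split.
- exact: measurableU.
- by move=> x [/D1I[]|/D2D[]].
- rewrite half -hD1 -hD2; apply: measureU => //.
  by apply/seteqP; split=> // x [/D1I[_ ?] /D2D[_]].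
- have mY (X Y : set T) : measurable X -> measurable Y -> measurable (X `+` Y).
    by move=> ? ?; apply: measurableU; exact: measurableD.
  move=> C'; rewrite inE => /predU1P[->|C'l].
    (* Inside [C] the symmetric difference keeps what [D1] misses, outside it keeps [D2]; each is
       half of its piece. *)
    have -> : B `&` ((D1 `|` D2) `+` C) = (B `&` C `\` D1) `|` D2.
      apply/seteqP; split=> x /=.
        move=> [Bx [[[D1x|D2x] Cx]|[Cx D12x]]].
        + by case: (D1I _ D1x).
        + by right.
        + by left; split=> // D1x; apply: D12x; left.
      move=> [[[Bx Cx] D1x]|D2x].
        split=> //; right; split=> // -[//|/D2D[]//].
      have [Bx Cx] := D2D _ D2x.
      by split=> //; left; split=> //; right.
    have := measure_splitD mu mD1 mI D1I.
    have mID : measurable (B `&` C `\` D1) by exact: measurableD.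
    have IDB : B `&` C `\` D1 `<=` B by move=> x [[]].
    have -> : mu ((B `&` C `\` D1) `|` D2) = mu (B `&` C `\` D1) + mu D2.
      apply: measureU => //.
      by apply/seteqP; split=> // x [[[_ Cx] _] /D2D[]].
    rewrite (measure_subset_fineK mID mB IDB By) hD1 hD2 Ifin half -!EFinD.
    by move=> [] /= E; congr EFin; lra.
  have mC' := ml' _ C'l.
  have -> : B `&` ((D1 `|` D2) `+` C') =
      (B `&` C) `&` (D1 `+` C') `|` (B `\` C) `&` (D2 `+` C').
    apply/seteqP; split=> x; have := D1I x; have := D2D x => /=;
      case: (pselect (C x)); tauto.
  rewrite half -(D1l _ C'l) -(D2l _ C'l); apply: measureU.
  + by apply: measurableI => //; exact: mY.
  + by apply: measurableI => //; exact: mY.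
  + by apply/seteqP; split=> // x [[[_ ?] _] [[_]]].
Qed.

(** * Finite nets and failure of compactness *)

Lemma compact_finite_net (R : numDomainType) (M : pseudoMetricType R)
    (U : set M) (e : R) : compact U -> (0 < e)%R ->
  exists l : seq M, forall y, U y -> exists2 c, c \in l & ball c e y.
Proof.
move=> /compact_near_coveringP cU e0.
(* Finite sets of centres, directed by inclusion. *)
pose F : set_system (seq M) :=
  [set S | exists l0 : seq M, forall l, {subset l0 <= l} -> S l].
have FF : Filter F.
  split.
  - by exists [::].
  - move=> S1 S2 [l1 h1] [l2 h2]; exists (l1 ++ l2) => l sub.
    by split; [apply: h1|apply: h2] => x xl; apply: sub; rewrite mem_cat xl ?orbT.
  - by move=> S1 S2 S12 [l0 h]; exists l0 => l /h/S12.
pose P (l : seq M) y := exists2 c, c \in l & ball c e y.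
have [x Ux|l0 h] := cU _ F P FF; last by exists l0 => y; apply: (h l0).
(* Near [x], the centre [x] itself serves, as soon as the list contains it. *)
exists (ball x e, [set l | x \in l]).
  split; first exact: nbhsx_ballx.
  by exists [:: x] => l; apply; rewrite inE.
by move=> [y l] /= [xy xl]; exists x.
Qed.

Theorem theorem3p7 (d : measure_display) (T : measurableType d) (R : realType)
    (mu : {measure set T -> \bar R})
    (mu_nontrivial : exists2 A : set T, measurable A & 0 < mu A < +oo)
    (mu_non_atomic : non_atomic mu) :
  ~ compact [set: malgebra mu] /\ ~ locally_compact [set: malgebra mu].
Proof.
(* In a compact space the whole space is a compact neighbourhood of each point. *)
suff nlc : ~ locally_compact [set: malgebra mu].
  split=> // cM; apply: nlc; apply/malgebra_locally_compactE => x.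
  by exists [set: malgebra mu] => //; exact: filterT.
move=> /malgebra_locally_compactE/(_ (to_malgebra mu measurable0))[U + cU].
rewrite -nbhs_ballE => -[e /= e0 eU].
have [A mA A0y] := mu_nontrivial; have /andP[_ Ay] := A0y.
(* [dmu] is a square root: a set of measure at most [(e / 2) ^+ 2] is within [e / 2 < e] of the
   empty set. *)
have e20 : (0 < (e / 2) ^+ 2)%R by rewrite exprn_gt0// divr_gt0.
have [B [mB BA B0 Be]] := non_atomic_small mu_non_atomic mA A0y e20.
have Bfin := measure_subset_fineK mB mA BA Ay.
have By : mu B < +oo by rewrite Bfin ltry.
move: B0; rewrite Bfin lte_fin => B0.
have r0 : (0 < Num.sqrt (fine (mu B) / 2))%R by rewrite sqrtr_gt0 divr_gt0.
have [l lU] := compact_finite_net cU r0.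
have [|D [mD DB _ Dl]] := @non_atomic_independent _ _ _ mu
    (map (@mrepr _ _ _ mu) l) B mu_non_atomic _ mB By.
  by move=> C /mapP[c _ ->]; exact: measurable_mrepr.
have UD : U (to_malgebra mu mD).
  apply: eU; rewrite malgebra_ballE/= dmuE set0Y.
  apply: (@le_lt_trans _ _ (e / 2)%:E); last by rewrite lte_fin; lra.
  rewrite poweR12_sqrt// (measure_subset_fineK mD mB DB By)/= lee_fin.
  rewrite -[leRHS]ger0_norm ?divr_ge0 ?(ltW e0)// -sqrtr_sqr ler_sqrt ?(ltW e20)//.
  rewrite -lee_fin -(measure_subset_fineK mD mB DB By).
  by apply: le_trans Be; apply: le_measure; rewrite ?inE.
have [c cl] := lU _ UD.
rewrite malgebra_ballE/=; apply/negP; rewrite -leNgt.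
have mc := measurable_mrepr c.
(* Writing [c] as the class of its representative lets [dmuE] compute the distance to [D]. *)
have -> : c = to_malgebra mu mc by apply: val_inj; rewrite /= mclass_mrepr.
rewrite dmuE poweR12_sqrt//.
have mcD : measurable (mrepr c `+` D) by apply: measurableU; exact: measurableD.
rewrite -[leLHS]/(sqrte (fine (mu B) / 2)%:E) lee_sqrt//.
(* The part of the symmetric difference inside [B] already has measure [mu B / 2], so [D] lies
   outside the open ball around [c]. *)
rewrite setYC -(Dl (mrepr c)); last exact: map_f.
apply: le_measure; rewrite ?inE; [apply: measurableI|by rewrite setYC|] => //.
by rewrite setYC.
Qed.
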